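(* Let $\mathbb{K}$ be any field and let $1\le k\le m$ be integers. Then $$\mathcal{S}(k)+\mathcal{S}(m)\supseteq\Big\{\alpha=\sum_{n}\alpha_n t^{-n}\in\mathbb{K}((t^{-1})) : \alpha_n=0 \text{ for every integer } 1\le n<\max\{k,\tfrac{m-1}{2}\}\Big\}.$$
   Context: $\mathbb{K}((t^{-1}))$ is the field of formal Laurent series $\alpha=\sum_{n=-\infty}^{\infty}\alpha_n t^{-n}$ over the field $\mathbb{K}$ (only finitely many nonzero $\alpha_n$ with $n<0$), with $\deg\alpha=\sup\{-n:\alpha_n\ne0\}$. Every $\alpha$ has a unique continued fraction expansion $[a_0;a_1,a_2,\dots]$ with $a_n\in\mathbb{K}[t]$, $\deg a_n\ge1$ for $n\ge1$, finite iff $\alpha\in\mathbb{K}(t)$. $a_n(\alpha)$ denotes the $n$-th partial quotient (when defined) and $d_n(\alpha)=\deg a_n(\alpha)$. For $k\ge1$, $\mathcal{S}(k)=\{\alpha\in\mathbb{K}((t^{-1})): d_n(\alpha)\ge k \text{ for every } n\ge1 \text{ for which } a_n(\alpha)\text{ is defined}\}$. *)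

(* Defs.v *)
(* Laurent series in t^{-1} over a field K are represented by
   their coefficient functions  a : int -> K,  with  alpha = \sum_n a n * t^{-n},
   subject to the predicate [laurent] (only finitely many nonzero a n, n < 0). *)
From HB Require Import structures.
From mathcomp Require Import all_boot all_order all_algebra.
Set Implicit Arguments. Unset Strict Implicit. Unset Printing Implicit Defensive.
Import Order.TTheory GRing.Theory Num.Theory.
Local Open Scope ring_scope.

Section LaurentDefs.
Variable K : fieldType.

Definition laurent (a : int -> K) : Prop :=
  exists N : int, forall n : int, n < N -> a n = 0.

(* coefficient of t^{-m} of the product, computed with a common lower bound N
   for the supports of a and b:  \sum_{j} a_j b_{m-j}  (j ranges over N..m-N;
   extra terms in the range below vanish). *)
Definition lmul_coef (N : int) (a b : int -> K) (m : int) : K :=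
  \sum_(i < (absz (m - 2 * N)%R).+1) a (N + i%:Z) * b (m - N - i%:Z).

Definition linv (a b : int -> K) : Prop :=
  exists N : int,
    (forall n : int, n < N -> a n = 0 /\ b n = 0) /\
    (forall m : int, lmul_coef N a b m = (m == 0)%:R).

Definition lfrac (a : int -> K) : int -> K :=
  fun n => if (1 <= n) then a n else 0.

Inductive cq (a : int -> K) : nat -> (int -> K) -> Prop :=
  | cq0 : cq a 0 a
  | cqS : forall n b c, cq a n b -> (exists j, lfrac b j != 0) -> linv (lfrac b) c ->
          cq a n.+1 c.

Definition is_polypart (a : int -> K) (p : {poly K}) : Prop :=
  forall i : nat, p`_i = a (- (i%:Z)).

Definition partial_quotient (a : int -> K) (n : nat) (p : {poly K}) : Prop :=
  exists b, cq a n b /\ is_polypart b p.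

Definition Sk (k : nat) (a : int -> K) : Prop :=
  laurent a /\
  forall (n : nat) (p : {poly K}), (1 <= n)%N -> partial_quotient a n p ->
    (k <= (size p).-1)%N.

End LaurentDefs.

(* Main.v *)
(* The series alpha is split greedily as x + y, where x and y are rational and
   are improved in turn: x is replaced by the next convergent of alpha - y, then
   y by the next convergent of alpha - x, and so on.  If Dx, Dy are the degrees
   of the denominators, then x + y agrees with alpha up to index 2 max(Dx, Dy).
   When y, the older of the two, is improved at the first mismatch e > 2 Dx,
   its new partial quotient has degree e - 2 Dy; the inequality
   2 Dy + m <= 2 Dx + 1 makes this at least m, and it holds again with the
   roles of x and y exchanged.  The vanishing hypothesis on alpha is what starts
   the process: the first mismatch e with 0 is then at least k and (m-1)/2.

   Membership in S(k) is checked by Diophantine approximation: it suffices that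
   for every D some q <> 0 of degree at most D satisfies
   ||q alpha|| < t^-D and ||q alpha|| <= t^-(deg q + k), and this property is
   preserved by alpha |-> 1 / {alpha}. *)
Require Import Defs.
From HB Require Import structures.
From mathcomp Require Import all_boot all_order all_algebra.
From mathcomp Require Import zify.
From Stdlib Require Import Classical ClassicalEpsilon.
Import Order.TTheory GRing.Theory Num.Theory.
Local Open Scope ring_scope.

(** * Polynomials acting on fractional series *)

Section Shift.
Set Implicit Arguments.
Unset Strict Implicit.
Variable K : fieldType.
Implicit Types (p q r : {poly K}) (u x y z : nat -> K) (k m D n e : nat).

(* [u n] stands for the coefficient of t^-(n+1), so that [act q u] is the
   fractional part of the product of [q] by the fractional series [u]. *)
Definition act q u n : K := \sum_(i < size q) q`_i * u (n + i)%N.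

Lemma act_wide L q u n : (size q <= L)%N ->
  act q u n = \sum_(i < L) q`_i * u (n + i)%N.
Proof.
move=> le_qL; rewrite /act (big_ord_widen L (fun i => q`_i * u (n + i)%N)) //.
rewrite big_mkcond /=; apply: eq_bigr => i _.
by case: ltnP => // le_qi; rewrite nth_default ?mul0r.
Qed.

Lemma eq_act q u v n : (forall i, (i < size q)%N -> u (n + i)%N = v (n + i)%N) ->
  act q u n = act q v n.
Proof. by move=> uv; apply: eq_bigr => i _; rewrite uv. Qed.

Lemma act_eq0 q u n : (forall i, (i < size q)%N -> u (n + i)%N = 0) ->
  act q u n = 0.
Proof. by move=> u0; apply: big1 => i _; rewrite u0 ?mulr0. Qed.

Lemma actC p q u n : act p (act q u) n = act q (act p u) n.
Proof.
rewrite /act; under eq_bigr do rewrite mulr_sumr.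
rewrite exchange_big /=; apply: eq_bigr => j _; rewrite mulr_sumr.
by apply: eq_bigr => i _; rewrite mulrCA addnAC.
Qed.

Lemma act_lead D q u n : size q = D.+1 ->
  (forall i, (i < D)%N -> u (n + i)%N = 0) -> act q u n = lead_coef q * u (n + D)%N.
Proof.
move=> sq u0; rewrite (@act_wide D.+1) ?sq // big_ord_recr /= lead_coefE sq big1 ?add0r //.
by move=> i _; rewrite u0 ?mulr0.
Qed.

Lemma sum_trunc (g : nat -> K) (A B : nat) :
  (forall l, (A <= l)%N -> g l = 0) -> (forall l, (B <= l)%N -> g l = 0) ->
  \sum_(l < A) g l = \sum_(l < B) g l.
Proof.
move=> gA gB.
have aux C : (forall l, (C <= l)%N -> g l = 0) ->
    forall C', (C <= C')%N -> \sum_(l < C) g l = \sum_(l < C') g l.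
  move=> gC C' leC; rewrite (big_ord_widen C' g) // big_mkcond /=.
  by apply: eq_bigr => i _; case: ltnP => // /gC.
by rewrite (aux A gA (maxn A B)) ?leq_maxl // (aux B gB (maxn A B)) ?leq_maxr.
Qed.

(** * Dirichlet approximation and series with a given denominator *)

Lemma dirichlet D u :
  exists2 q : {poly K}, q != 0 &
    (size q <= D.+1)%N /\ forall n, (n < D)%N -> act q u n = 0.
Proof.
pose A : 'M[K]_(D.+1, D) := \matrix_(i, j) u (j + i)%N.
have : kermx A != 0.
  rewrite -mxrank_eq0 mxrank_ker subn_eq0 -ltnNge.
  exact: leq_ltn_trans (rank_leq_col A) _.
case/rowV0Pn => v /sub_kermxP vA v0.
exists (rVpoly v).
  by apply: contraNneq v0 => rv0; rewrite -(rVpolyK v) rv0 linear0.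
split=> [|n ltnD]; first exact: size_poly.
rewrite (@act_wide D.+1) ?size_poly //.
have /matrixP/(_ 0 (Ordinal ltnD)) := vA; rewrite !mxE => vA0.
by apply: etrans vA0; apply: eq_bigr => i _; rewrite coef_rVpoly_ord [A _ _]mxE.
Qed.

(** One term of the recurrence that [q] imposes on a series it annihilates: [l] is the history of
    earlier terms, and the [D] initial ones are free, taken from [z]. *)
Definition rec_step D q z (l : seq K) : K :=
  if (size l < D)%N then z (size l)
  else - (\sum_(i < D) q`_i * l`_(size l - D + i)) / lead_coef q.

Definition rec_hist D q z n := iter n (fun l => rcons l (rec_step D q z l)) [::].

Definition rec_seq D q z n := rec_step D q z (rec_hist D q z n).

Lemma rec_histE D q z n : rec_hist D q z n = mkseq (rec_seq D q z) n.
Proof. by elim: n => //= n IH; rewrite mkseqS -IH. Qed.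

Lemma rec_seqE D q z n : rec_seq D q z n =
  if (n < D)%N then z n
  else - (\sum_(i < D) q`_i * rec_seq D q z (n - D + i)%N) / lead_coef q.
Proof.
rewrite {1}/rec_seq rec_histE /rec_step size_mkseq; case: ltnP => // leDn.
congr (- _ / _); apply: eq_bigr => i _; rewrite nth_mkseq //.
by have := ltn_ord i; lia.
Qed.

Lemma act_rec_seq D q z n : size q = D.+1 -> act q (rec_seq D q z) n = 0.
Proof.
move=> sq; rewrite (@act_wide D.+1) ?sq // big_ord_recr /=.
rewrite [rec_seq _ _ _ (n + D)%N]rec_seqE ltnNge leq_addl /= addnK.
have -> : q`_D = lead_coef q by rewrite lead_coefE sq.
rewrite mulrC divfK ?subrr // lead_coef_eq0 -size_poly_eq0 sq //.
Qed.

(** Below index [2 D], [z] obeys the recurrence of [q] as well, with the same [D] initial terms. *)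
Lemma rec_seq_prefix D q z : size q = D.+1 ->
  (forall n, (n < D)%N -> act q z n = 0) ->
  forall n, (n < D.*2)%N -> rec_seq D q z n = z n.
Proof.
move=> sq qz n; elim/ltn_ind: n => n IH ltn; rewrite rec_seqE; case: ltnP => // leDn.
have lq : lead_coef q != 0 by rewrite lead_coef_eq0 -size_poly_eq0 sq.
have := qz (n - D)%N; rewrite (@act_wide D.+1) ?sq // big_ord_recr /= subnK //.
have <- : lead_coef q = q`_D by rewrite lead_coefE sq.
move/(_ ltac:(lia))/eqP; rewrite addrC addr_eq0 => /eqP qzn.
apply: (mulfI lq); rewrite qzn mulrC divfK //; congr (- _).
by apply: eq_bigr => i _; rewrite IH //; have := ltn_ord i; lia.
Qed.

(** * Approximability and convergents *)

Definition approximable k u D := exists2 q : {poly K}, q != 0 & (size q <= D.+1)%N /\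
  forall n, (n < D)%N \/ (n.+2 < size q + k)%N -> act q u n = 0.

(* [cv_min] is the nonvanishing of the Hankel determinant of order [D].
   [cv_approx] is stated for every [u] sharing the prefix of [x], so that it
   passes to the limit of a sequence of convergents. *)
Record convergent k D q x : Prop := Convergent {
  cv_size : size q = D.+1;
  cv_act : forall n, act q x n = 0;
  cv_min : forall r, (size r <= D)%N -> (forall n, (n < D)%N -> act r x n = 0) -> r = 0;
  cv_approx : forall D0 u, (D0 < D)%N -> (forall n, (n < D.*2)%N -> u n = x n) ->
    approximable k u D0 }.

Lemma convergent0 k : convergent k 0 1 (fun=> 0).
Proof.
split=> // [|n|r]; first by rewrite size_poly1.
  by apply: act_eq0.
by rewrite leqn0 size_poly_eq0 => /eqP.
Qed.

Lemma convergent_approx k D q x : convergent k D q x -> forall D0, approximable k x D0.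
Proof.
case=> sq qx _ ax D0; case: (ltnP D0 D) => [/ax|leD]; first exact.
by exists q; rewrite -?size_poly_eq0 sq.
Qed.

(** The series [q z] has its first nonzero coefficient at index [e - D], so the denominator after
    [q] in the expansion of [z] has degree [e + 1 - D], and the partial quotient between them has
    degree [e + 1 - 2 D], at least [k]. *)
Lemma convergent_next k D q x z e : convergent k D q x ->
  (forall n, (n < e)%N -> z n = x n) -> z e != x e ->
  (D.*2 + k <= e.+1)%N -> (0 < k)%N ->
  exists q' x', convergent k (e.+1 - D) q' x' /\
    forall n, (n < (e.+1 - D).*2)%N -> x' n = z n.
Proof.
case=> sq qx minq ax zx zxe leD k0; set D' := (e.+1 - D)%N.
have q0 : q != 0 by rewrite -size_poly_eq0 sq.
have qz n : (n.+1 < D')%N -> act q z n = 0.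
  move=> ltn; rewrite -(qx n); apply: eq_act => i; rewrite sq => lti.
  by apply: zx; rewrite /D' in ltn; lia.
have qzD : act q z D'.-1 != 0.
  have -> : act q z D'.-1 = lead_coef q * (z e - x e).
    rewrite -[LHS]subr0 -[in LHS](qx D'.-1) !(@act_wide D.+1) ?sq // -sumrB big_ord_recr /=.
    rewrite big1 => [|i _]; last first.
      by rewrite zx ?subrr //; have := ltn_ord i; rewrite /D'; lia.
    have -> : (D'.-1 + D)%N = e by rewrite /D'; lia.
    by rewrite add0r -mulrBr lead_coefE sq.
  by rewrite mulf_neq0 ?subr_eq0 ?lead_coef_eq0.
have minz r : (size r <= D')%N -> (forall n, (n < D')%N -> act r z n = 0) -> r = 0.
  move=> sr rz; case: (leqP (size r) D) => [le_rD|lt_Dr].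
    apply: minq => // n ltn; rewrite -(rz n); last by rewrite /D'; lia.
    by apply: eq_act => i lti; rewrite zx //; lia.
  (* The coefficient of [r q z] at [D' - 1 - d] is [lead_coef r] times the first nonzero coefficient
     of [q z]; it vanishes because [r z] vanishes below [D']. *)
  have [d sr'] : exists d, size r = d.+1 by exists (size r).-1; lia.
  have : act r (act q z) (D'.-1 - d) = 0.
    by rewrite actC; apply: act_eq0 => i; rewrite sq => lti; apply: rz; rewrite /D' in sr *; lia.
  rewrite (@act_lead d) // => [/eqP|i lti]; last by apply: qz; lia.
  rewrite mulf_eq0 subnK ?(negPf qzD) ?orbF ?lead_coef_eq0; last by lia.
  by move/eqP.
(* [minz] forces the Dirichlet denominator to have degree exactly [D']. *)
have [q' q'0 [sq' q'z]] := dirichlet D' z.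
have {}sq' : size q' = D'.+1.
  apply/eqP; rewrite eqn_leq sq' ltnNge; apply/negP => /minz.
  by move/(_ q'z)/eqP; rewrite (negPf q'0).
have x'z := rec_seq_prefix sq' q'z.
exists q', (rec_seq D' q' z); split=> //; split=> // [n|r sr rx|D0 u lt0 ux].
- exact: act_rec_seq.
- apply: minz => // n ltn; rewrite -(rx n) //; apply: eq_act => i lti.
  by rewrite x'z //; lia.
have ue n : (n < e)%N -> u n = x n.
  by move=> ltn; rewrite ux ?x'z ?zx // /D'; lia.
case: (ltnP D0 D) => [lt0D|le0D].
  by apply: ax => // n ltn; apply: ue; lia.
(* From [D] up to [D' - 1] the old denominator still serves: [q u] vanishes below index [e - D],
   which is at least [D + k - 1]. *)
exists q => //; split; rewrite sq // => n Hn.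
rewrite -(qx n); apply: eq_act => i; rewrite sq => lti; apply: ue.
by rewrite /D' in lt0; lia.
Qed.

Lemma first_mismatch u v : ~ (forall n, u n = v n) ->
  exists2 e, u e != v e & forall n, (n < e)%N -> u n = v n.
Proof.
move=> uv; have [n0 uv0] := not_all_ex_not _ _ uv.
have ex : exists n, u n != v n by exists n0; apply/eqP.
case: (ex_minnP ex) => e uve mine; exists e => // n ltn; apply/eqP.
by apply: contraLR ltn => /mine; rewrite -leqNgt.
Qed.

(** * Greedy construction of the two summands *)

Section Decomposition.
Variables (k m : nat) (u : nat -> K).
Hypotheses (k_gt0 : (0 < k)%N) (le_km : (k <= m)%N).
Hypothesis u0 : forall e, (e.+1 < k)%N \/ (2 * e.+1 + 1 < m)%N -> u e = 0.

Record pairing (x y : nat -> K) (Dx Dy : nat) : Prop := Pairing {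
  pr_x : exists q, convergent k Dx q x;
  pr_y : exists q, convergent m Dy q y;
  pr_sum : forall n, (n < Dx.*2)%N -> u n = x n + y n;
  pr_lead : (Dy.*2 + m <= Dx.*2.+1)%N }.

(** The process stops only here, with both summands rational. *)
Definition exact_sum := exists x y Dx Dy qx qy,
  [/\ convergent k Dx qx x, convergent m Dy qy y & forall n, u n = x n + y n].

Lemma pairing_init : ~ exact_sum -> exists x y Dx Dy, pairing x y Dx Dy.
Proof.
move=> nex; have [|e ue ltue] := @first_mismatch u (fun=> 0).
  by move=> uz; apply: nex; exists (fun=> 0), (fun=> 0), 0%N, 0%N, 1, 1; split; rewrite ?uz ?addr0 //;
     apply: convergent0.
have ge_e : ~ ((e.+1 < k)%N \/ (2 * e.+1 + 1 < m)%N) by move/u0/eqP; rewrite (negPf ue).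
have [||q [x [cx xu]]] := convergent_next (convergent0 k) ltue ue.
- by have := ge_e; lia.
- exact: k_gt0.
(* With [Dx = e + 1] and [Dy = 0], [pr_lead] is the bound [m <= 2 (e + 1) + 1] from the second half
   of the vanishing hypothesis. *)
exists x, (fun=> 0), (e.+1 - 0)%N, 0%N; split.
- by exists q.
- by exists 1; apply: convergent0.
- by move=> n ltn; rewrite xu ?addr0.
- by have := ge_e; lia.
Qed.

Lemma pairing_next x y Dx Dy : ~ exact_sum -> pairing x y Dx Dy ->
  exists x' y' Dx' Dy', pairing x' y' Dx' Dy' /\
    [/\ (Dx < Dx')%N, (Dy < Dy')%N
      & forall n, (n < Dx.*2)%N -> x' n = x n /\ y' n = y n].
Proof.
move=> nex [[qx cx] [qy cy] sxy lead].
have [|e ze lte] := @first_mismatch (fun n => u n - x n) y.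
  move=> uxy; apply: nex; exists x, y, Dx, Dy, qx, qy; split=> // n.
  by rewrite -uxy addrC subrK.
have gee : (Dx.*2 <= e)%N.
  by rewrite leqNgt; apply: contra_neqN ze => /sxy ->; rewrite addrC addKr.
have [||qy' [y' [cy' y'u]]] := convergent_next cy lte ze; try lia.
set Dy' := (e.+1 - Dy)%N in cy' y'u.
have [|f zf ltf] := @first_mismatch (fun n => u n - y' n) x.
  move=> uxy; apply: nex; exists x, y', Dx, Dy', qx, qy'; split=> // n.
  by rewrite -uxy subrK.
have gef : (Dy'.*2 <= f)%N.
  by rewrite leqNgt; apply: contra_neqN zf => /y'u ->; rewrite subKr.
(* From [f >= 2 Dy'], [Dy' = e + 1 - Dy], [2 Dy + m <= e + 1] and [2 Dx <= e] follows
   [f + 1 > 2 Dx + m]. As [k <= m], this suffices here; it also gives the new [pr_lead]. *)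
have [|//|qx' [x' [cx' x'u]]] := convergent_next cx ltf zf; first by rewrite /Dy' in gef; lia.
exists x', y', (f.+1 - Dx)%N, Dy'; split; split.
- by exists qx'.
- by exists qy'.
- by move=> n /x'u ->; rewrite subrK.
- by rewrite /Dy' in gef *; lia.
- by rewrite /Dy' in gef *; lia.
- by rewrite /Dy' in gef *; lia.
- move=> n ltn; split; first by rewrite x'u ?ltf //; rewrite /Dy' in gef; lia.
  by rewrite y'u ?lte //; rewrite /Dy'; lia.
Qed.

(** The diagonal reads coefficient [n] at stage [n + 1], where it has settled: a strictly increasing
    [B] satisfies [n < B (n + 1)]. *)
Lemma limit_stable (w : nat -> nat -> K) (B : nat -> nat) :
  (forall j, (B j < B j.+1)%N) ->
  (forall j n, (n < B j)%N -> w j.+1 n = w j n) ->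
  forall j n, (n < B j)%N -> w n.+1 n = w j n.
Proof.
move=> ltB wS.
have leB i j : (i <= j)%N -> (B i <= B j)%N.
  by move/subnKC <-; elim: (j - i)%N => [|d IH]; rewrite ?addn0 // addnS (leq_trans IH) // ltnW.
have wD i d n : (n < B i)%N -> w (i + d)%N n = w i n.
  move=> lt; elim: d => [|d IH]; rewrite ?addn0 // addnS wS //.
  by rewrite (leq_trans lt) // leB ?leq_addr.
have geB n : (n < B n.+1)%N.
  by elim: n => [|n IH]; [exact: leq_ltn_trans (ltB 0%N)|exact: leq_ltn_trans (ltB _)].
move=> j n lt; case: (leqP j n.+1) => [/subnKC <-|/ltnW/subnKC <-]; first by rewrite wD.
by rewrite wD.
Qed.

Lemma approximable_decomposition : exists x y : nat -> K,
  [/\ forall D, approximable k x D, forall D, approximable m y D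
     & forall n, u n = x n + y n].
Proof.
case: (classic exact_sum) => [[x [y [Dx [Dy [qx [qy [cx cy uxy]]]]]]]|nex].
  by exists x, y; split; [exact: convergent_approx cx|exact: convergent_approx cy|].
pose state := ((nat -> K) * (nat -> K) * nat * nat)%type.
pose good (s : state) := pairing s.1.1.1 s.1.1.2 s.1.2 s.2.
pose next (s t : state) := [/\ (s.1.2 < t.1.2)%N, (s.2 < t.2)%N
  & forall n, (n < s.1.2.*2)%N -> t.1.1.1 n = s.1.1.1 n /\ t.1.1.2 n = s.1.1.2 n].
have step (s : {s | good s}) : {t : {s | good s} | next (sval s) (sval t)}.
  apply: constructive_indefinite_description.
  case: s => [[[[x y] Dx] Dy] gs].
  have [x' [y' [Dx' [Dy' [gt nt]]]]] := pairing_next nex gs.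
  by exists (exist _ (x', y', Dx', Dy') gt).
have [s0 gs0] : exists s, good s.
  by have [x [y [Dx [Dy g]]]] := pairing_init nex; exists (x, y, Dx, Dy).
pose st j := iter j (fun s => sval (step s)) (exist _ s0 gs0).
have stS j : next (sval (st j)) (sval (st j.+1)) by rewrite /= ; case: (step _).
pose x j := (sval (st j)).1.1.1; pose y j := (sval (st j)).1.1.2.
pose Dx j := (sval (st j)).1.2; pose Dy j := (sval (st j)).2.
have gst j : pairing (x j) (y j) (Dx j) (Dy j) := svalP (st j).
have ltDx j : (Dx j < Dx j.+1)%N by case: (stS j).
have ltDy j : (Dy j < Dy j.+1)%N by case: (stS j).
have ltB j : ((Dx j).*2 < (Dx j.+1).*2)%N by rewrite ltn_double.
have growth (D : nat -> nat) : (forall j, (D j < D j.+1)%N) -> forall j, (j <= D j)%N.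
  by move=> ltD; elim=> // j IH; apply: leq_ltn_trans IH (ltD j).
have xlim := limit_stable ltB (fun j n lt => (let: And3 _ _ H := stS j in H n lt).1).
have ylim := limit_stable ltB (fun j n lt => (let: And3 _ _ H := stS j in H n lt).2).
exists (fun n => x n.+1 n), (fun n => y n.+1 n); split=> [D|D|n].
- have [[q cx] _ _ _] := gst D.+1.
  apply: (cv_approx cx) => [|n ltn]; [exact: growth ltDx D.+1|exact: xlim].
(* [ylim] settles [y] only below [2 Dx], which is enough: [pr_lead] and [m >= 1] give [Dy <= Dx]. *)
- have [_ [q cy] _ lead] := gst D.+1.
  apply: (cv_approx cy) => [|n ltn]; [exact: growth ltDy D.+1|apply: ylim; lia].
- apply: (pr_sum (gst n.+1)); have := growth _ ltDx n.+1; lia.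
Qed.

End Decomposition.

(** * Inversion of the fractional part and membership in S(k) *)

Definition tail (a : int -> K) n : K := a n.+1%:Z.

(** Frees the convolution in [linv] from its support bound [N]: [{b}] starts at exponent 1, and the
    sum may stop anywhere past the support of [c]. *)
Lemma linv_sum (b c : int -> K) : linv (lfrac b) c -> forall (j : int) (L : nat),
  (forall l : nat, (L <= l)%N -> c (j - 1 - l%:Z) = 0) ->
  \sum_(l < L) tail b l * c (j - 1 - l%:Z) = (j == 0)%:R.
Proof.
case=> N [N0 convE] j L cL.
have leN1 : N <= 1.
  rewrite leNgt; apply/negP => gtN1; have := convE 0.
  rewrite /lmul_coef big1 => [/eqP|i _]; first by rewrite eqxx eq_sym oner_eq0.
  by have [_ ->] := N0 (0 - N - i%:Z) ltac:(lia); rewrite mulr0.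
have [P defN] : exists P : nat, N = 1 - P%:Z by exists `|1 - N|%N; lia.
rewrite -convE /lmul_coef; set M := (absz _).+1.
pose g (i : nat) := lfrac b (N + i%:Z) * c (j - N - i%:Z).
have gM (l : nat) : (M <= l)%N -> g l = 0.
  by move=> leMl; rewrite /g; have [_ ->] := N0 (j - N - l%:Z) ltac:(lia); rewrite mulr0.
rewrite -/(\sum_(l < M) g l) (@sum_trunc g M (P + M)%N) //; last by move=> l lel; apply: gM; lia.
rewrite big_split_ord /= [X in _ = X + _]big1 ?add0r => [|i _]; last first.
  by rewrite /g /lfrac ifF ?mul0r //; have := ltn_ord i; lia.
have gP (l : nat) : g (P + l)%N = tail b l * c (j - 1 - l%:Z).
  by rewrite /g /lfrac /tail ifT; [congr (b _ * c _)|]; lia.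
under [RHS]eq_bigr do rewrite gP.
apply: (@sum_trunc (fun l => tail b l * c (j - 1 - l%:Z))) => l lel; first by rewrite cL ?mulr0.
by rewrite -gP gM //; lia.
Qed.

Lemma linv_lead (b c : int -> K) d : linv (lfrac b) c ->
  (forall l, (l < d)%N -> tail b l = 0) -> tail b d != 0 ->
  (forall i : int, i < - d.+1%:Z -> c i = 0) /\ tail b d * c (- d.+1%:Z) = 1.
Proof.
move=> inv ud0 ud.
have lead (i : int) : (forall i' : int, i' < i -> c i' = 0) ->
    tail b d * c i = (i == - d.+1%:Z)%:R.
  move=> ci; have := linv_sum inv (j := i + d.+1%:Z) (L := d.+1).
  rewrite big_ord_recr /= big1 => [|l _]; last by rewrite ud0 ?mul0r.
  rewrite add0r (_ : i + d.+1%:Z - 1 - d%:Z = i); last by lia.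
  rewrite addr_eq0 => -> // l ltl; apply: ci; lia.
have [N [N0 _]] := inv.
(* Starting from the support bound [N], the comparison [lead] kills the coefficients of [c] one at a
   time. *)
have small t : N + t%:Z <= - d.+1%:Z -> forall i' : int, i' < N + t%:Z -> c i' = 0.
  elim: t => [|t IH] let_ i' lti; first by apply: (N0 i' ltac:(lia)).2.
  have [lt|->] : i' < N + t%:Z \/ i' = N + t%:Z by lia.
    by apply: IH lt; lia.
  have /eqP := lead (N + t%:Z) (IH ltac:(lia)).
  rewrite (_ : (N + _ == _) = false); last by lia.
  by rewrite mulf_eq0 (negPf ud) => /eqP.
have low (i : int) : i < - d.+1%:Z -> c i = 0.
  move=> lti; case: (ltP i N) => [/N0[]|leNi] //.
  by apply: (small `|- d.+1%:Z - N|%N); lia.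
by split; rewrite ?lead ?eqxx.
Qed.

(** As [{b}] starts at [t^-(d+1)], multiplying by [c] raises degrees by [d + 1]. A denominator for
    [{b}] at level [D + d + 1] yields one for [c] at level [D], of degree smaller by [d + 1], so
    both error bounds survive. *)
Lemma approximable_linv k (b c : int -> K) d : linv (lfrac b) c ->
  (forall l, (l < d)%N -> tail b l = 0) -> tail b d != 0 ->
  (forall D, approximable k (tail b) D) -> forall D, approximable k (tail c) D.
Proof.
move=> inv ud0 ud aprx D; have [c0 _] := linv_lead inv ud0 ud.
have [q q0 [sq qu]] := aprx (D + d.+1)%N.
have [t st] : exists t, size q = t.+1.
  by exists (size q).-1; rewrite prednK // lt0n size_poly_eq0.
have ltdt : (d < t)%N.
  rewrite ltnNge; apply/negP => letd.
  have : act q (tail b) (d - t) = 0 by apply: qu; left; lia.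
  rewrite (act_lead st) => [/eqP|i lti]; last by apply: ud0; lia.
  by rewrite subnK // mulf_eq0 lead_coef_eq0 (negPf q0) (negPf ud).
(* [p] is the polynomial part of [q * {b}]; since [c = 1 / {b}], the series
   [p * c] and [q] differ by [c] times the fractional part of [q * {b}]. *)
pose f i := \sum_(j < t.+1 | (i < j)%N) q`_j * tail b (j.-1 - i)%N.
have f0 i : (t - d <= i)%N -> f i = 0.
  by move=> lei; apply: big1 => j ltij; rewrite ud0 ?mulr0 //; have := ltn_ord j; lia.
pose p : {poly K} := \poly_(i < t - d) f i.
have pE i : p`_i = f i by rewrite coef_poly; case: ltnP => // /f0.
have sp : size p = (t - d)%N.
  apply: size_poly_eq; rewrite /f (bigD1 ord_max) /=; last by lia.
  rewrite big1 => [|j /andP[ltj neq]]; last first.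
    by rewrite ud0 ?mulr0 //; move: neq; rewrite -val_eqE /=; have := ltn_ord j; lia.
  rewrite addr0 (_ : (t.-1 - (t - d).-1)%N = d); last by lia.
  by rewrite mulf_neq0 //; have := lead_coef_eq0 q; rewrite lead_coefE st /= => ->.
exists p; first by rewrite -size_poly_eq0 sp; lia.
split=> [|n Hn]; first by rewrite sp; lia.
have qn i : (i <= n + d.+1)%N -> act q (tail b) i = 0.
  by move=> lei; apply: qu; rewrite sp in Hn; rewrite st; lia.
have convE (j : nat) : \sum_(l < j + (n + d.+2)) tail b l * c (n%:Z + j%:Z - l%:Z) = 0.
  have := linv_sum inv (j := n.+1%:Z + j%:Z) (L := (j + (n + d.+2))%N).
  rewrite (_ : n.+1%:Z + j%:Z - 1 = n%:Z + j%:Z); last by lia.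
  by rewrite (_ : (_ == _) = false) => [-> // l lel|]; [apply: c0|]; lia.
have : \sum_(j < t.+1) q`_j *
    \sum_(l < j + (n + d.+2)) tail b l * c (n%:Z + j%:Z - l%:Z) = 0.
  by apply: big1 => j _; rewrite convE mulr0.
(* The terms [l < j] assemble into [p c]; the others carry the fractional part of [q {b}], which
   [qn] kills up to index [n + d + 1]. *)
under eq_bigr do rewrite big_split_ord /= mulrDr.
rewrite big_split /= [X in _ + X](_ : _ = 0) ?addr0; last first.
  under eq_bigr do rewrite mulr_sumr.
  rewrite exchange_big /= big1 // => r _.
  transitivity (act q (tail b) r * c (n%:Z - r%:Z)); last first.
    by rewrite qn ?mul0r //; have := ltn_ord r; lia.
  rewrite (@act_wide t.+1) ?st // mulr_suml; apply: eq_bigr => j _.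
  by rewrite mulrA addnC; congr (_ * c _); lia.
move=> sum0; rewrite (@act_wide t.+1); last by lia.
apply: etrans sum0.
under [LHS]eq_bigr do rewrite pE mulr_suml big_mkcond /=.
rewrite exchange_big /=; apply: eq_bigr => j _.
rewrite -big_mkcond /= mulr_sumr.
rewrite [RHS](reindex_inj rev_ord_inj) /=.
pose F l := q`_j * (tail b (j - l.+1)%N * c (n%:Z + j%:Z - (j - l.+1)%N%:Z)).
rewrite -/(\sum_(l < j) F l) (big_ord_widen t.+1 F) 1?ltnW //.
apply: eq_bigr => i ltij; rewrite /F mulrA; congr (_ * tail b _ * c _); lia.
Qed.

(** Approximability is inherited by every complete quotient. At [D = 0] the denominator is a
    constant, so the fractional part vanishes before [t^-k] and its inverse has degree at least
    [k]. *)
Lemma Sk_approximable k (b : int -> K) : laurent b ->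
  (forall D, approximable k (tail b) D) -> Sk k b.
Proof.
move=> lb aprx; split=> // n p n1 [c [cqc pc]].
have lead (b' : int -> K) : (exists j, lfrac b' j != 0) ->
    exists2 d, tail b' d != 0 & forall l, (l < d)%N -> tail b' l = 0.
  case=> j; rewrite /lfrac; case: ifP => [j1 bj|_]; last by rewrite eqxx.
  have ex : exists d, tail b' d != 0.
    by exists `|j|.-1; rewrite /tail (_ : _.+1%:Z = j) //; lia.
  case: (ex_minnP ex) => d ud mind; exists d => // l ltl; apply/eqP.
  by apply: contraLR ltl => /mind; rewrite -leqNgt.
have aprx_cq n' b' : cq b n' b' -> forall D, approximable k (tail b') D.
  elim=> // {}n' {}b' c' _ IH /lead[d ud ud0] inv.
  exact: approximable_linv inv ud0 ud IH.
case: cqc n1 pc => // {}n b' {}c /aprx_cq aprx' /lead[d ud ud0] inv _ pc.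
have [_ cd] := linv_lead inv ud0 ud.
have ltd : (d.+1 < size p)%N.
  rewrite ltnNge; apply/negP => /leq_sizeP/(_ d.+1 (leqnn _)).
  by rewrite pc => c0; move/eqP: cd; rewrite c0 mulr0 eq_sym oner_eq0.
suff : (k <= d.+1)%N by lia.
rewrite leqNgt; apply/negP => ltdk.
have [q q0 [sq qu]] := aprx' 0%N.
have {}sq : size q = 1%N by apply/eqP; rewrite eqn_leq sq lt0n size_poly_eq0.
have : act q (tail b') d = 0 by apply: qu; rewrite sq; lia.
rewrite (act_lead sq) // addn0 => /eqP.
by rewrite mulf_eq0 lead_coef_eq0 (negPf q0) (negPf ud).
Qed.

End Shift.

Theorem theorem1p2 (K : fieldType) (k m : nat) (a : int -> K) :
  (1 <= k)%N -> (k <= m)%N ->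
  laurent a ->
  (forall n : nat, (1 <= n)%N -> ((n < k)%N \/ (2 * n + 1 < m)%N) -> a (n%:Z) = 0) ->
  exists b c : int -> K, Sk k b /\ Sk m c /\ forall n : int, a n = b n + c n.
Proof.
move=> k1 lekm [N aN] a0.
have [e He|x [y [ax ay axy]]] := @approximable_decomposition K k m (tail a) k1 lekm.
  exact: a0.
(* The polynomial part of [a] goes entirely into the first summand. *)
exists (fun n => if n is Posz i.+1 then x i else a n).
exists (fun n => if n is Posz i.+1 then y i else 0).
split; [|split].
- apply: Sk_approximable => //; exists (Num.min N 0) => -[[|i]|i] ltn; try by apply: aN; lia.
  by lia.
- by apply: Sk_approximable => //; exists 0 => -[[|i]|i].
- by case=> [[|i]|i]; rewrite ?addr0 //; apply: axy.
Qed.
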